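(* Let $(M,h)$ be a complete Riemannian manifold, $x,y\in M$, and let $(X,g)$ be the spacetime associated to $(M,h)$. If $(M,h)$ is a $Y^{(x,y)}_l$ manifold for some $l>0$, then $(X,g)$ is strongly refocusing with respect to $p=(x,0)$ and $q=(y,l)$. If $(M,h)$ is a $Z^{(x,y)}$ manifold, then $(X,g)$ is observer-refocusing with respect to $p=(x,0)$ and the timelike curve $\gamma:\mathbb{R}\to X$, $\gamma(t)=(y,t)$.
   Context: All manifolds are smooth, connected and without boundary; geodesics are maximal. A spacetime is a time-oriented Lorentzian manifold. The spacetime associated to a Riemannian manifold $(M,h)$ is $X=M\times\mathbb{R}$ with metric $g=h\oplus -dt^2$ and time-orientation given by $\partial_t$. For $l>0$, a complete Riemannian manifold $(M,h)$ is a $Y^{(x,y)}_l$ manifold if for every geodesic $\alpha$ with $\alpha(0)=x$ and $h(\alpha'(0),\alpha'(0))=1$ we have $\alpha(l)=y$. It is a $Z^{(x,y)}$ manifold if for every (nonconstant) geodesic $\alpha$ with $\alpha(0)=x$ there is some $t>0$ with $\alpha(t)=y$. A spacetime $(X,g)$ is strongly refocusing with respect to $p\neq q$ in $X$ if all null-geodesics going through $p$ also go through $q$. It is observer-refocusing with respect to a point $p$ and a timelike curve $\gamma$ if for every future-oriented null-geodesic $\alpha$ with $\alpha(0)=p$ there is some $t>0$ with $\alpha(t)\in\mathrm{im}(\gamma)$. *)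

(* Defs.v *)
From HB Require Import structures.
From mathcomp Require Import all_boot all_order all_algebra.
From mathcomp Require Import all_classical all_reals all_analysis.

Set Implicit Arguments.
Unset Strict Implicit.
Unset Printing Implicit Defensive.

Import Order.TTheory GRing.Theory Num.Theory.
Import numFieldNormedType.Exports.

Local Open Scope classical_set_scope.
Local Open Scope ring_scope.

(* C^k and C^oo maps on an open subset [U] of a finite-dimensional space.  The
   maps are total functions, whose values outside [U] are irrelevant. *)
Fixpoint Ck (R : realType) (V W : normedModType R) (k : nat) (U : set V)
    (f : V -> W) : Prop :=
  if k is k'.+1 then
    (forall u, U u -> differentiable f u) /\
    (forall v, Ck k' U (fun u => 'D_v f u))
  else forall u, U u -> {for u, continuous f}.

Definition smooth (R : realType) (V W : normedModType R) (U : set V)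
    (f : V -> W) : Prop := forall k, Ck k U f.

(* The smooth structure is given by an atlas: the chart [i] is the
   homeomorphism [cmap i] from [cdom i] onto an open subset of R^n, with
   inverse [cinv i]. *)
Record manifold (R : realType) (n : nat) := Manifold {
  mspace :> topologicalType;
  mspace_hausdorff : hausdorff_space mspace;
  mspace_second_countable : @second_countable mspace;
  mspace_connected : connected [set: mspace];
  cindex : Type;
  cdom : cindex -> set mspace;
  cmap : cindex -> mspace -> 'rV[R]_n;
  cinv : cindex -> 'rV[R]_n -> mspace;
  cdom_open : forall i, open (cdom i);
  cimg_open : forall i, open (cmap i @` cdom i);
  cmapK : forall i p, cdom i p -> cinv i (cmap i p) = p;
  cmap_continuous : forall i p, cdom i p -> {for p, continuous (cmap i)};
  cinv_continuous : forall i u,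
    (cmap i @` cdom i) u -> {for u, continuous (cinv i)};
  cdom_cover : forall p, exists i, cdom i p;
  ctrans_smooth : forall i j,
    smooth (cmap i @` (cdom i `&` cdom j)) (cmap j \o cinv i) }.

Arguments cindex {R n} m.
Arguments cdom {R n m} i.
Arguments cmap {R n m} i.
Arguments cinv {R n m} i.

Definition cimg (R : realType) n (M : manifold R n) (i : cindex M) :
  set 'rV[R]_n := cmap i @` cdom i.

(* [overlap i j] is the domain of the transition map [ctrans i j], in the
   coordinates of [i]. *)
Definition overlap (R : realType) n (M : manifold R n) (i j : cindex M) :
  set 'rV[R]_n := cmap i @` (cdom i `&` cdom j).

Definition ctrans (R : realType) n (M : manifold R n) (i j : cindex M) :
  'rV[R]_n -> 'rV[R]_n := cmap j \o cinv i.

Definition bform (R : realType) n (G : 'M[R]_n) (v w : 'rV[R]_n) : R :=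
  (v *m G *m w^T) 0 0.

Definition qform (R : realType) n (G : 'M[R]_n) (v : 'rV[R]_n) : R :=
  bform G v v.

(* A semi-Riemannian metric, given by its matrix [mcoef i u] in the coordinates
   of each chart [i].  Tangent vectors are row vectors, on which the
   differential of [f] acts as [v |-> v *m 'J f u]. *)
Record metric (R : realType) n (M : manifold R n) := Metric {
  mcoef :> cindex M -> 'rV[R]_n -> 'M[R]_n;
  mcoef_smooth : forall i, smooth (cimg i) (mcoef i);
  mcoef_sym : forall i u, cimg i u -> (mcoef i u)^T = mcoef i u;
  mcoef_nondegenerate : forall i u, cimg i u -> mcoef i u \in unitmx;
  mcoef_trans : forall i j u, overlap i j u ->
    mcoef i u =
      'J (ctrans i j) u *m mcoef j (ctrans i j u) *m ('J (ctrans i j) u)^T }.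

Record vector_field (R : realType) n (M : manifold R n) := VectorField {
  vcoef :> cindex M -> 'rV[R]_n -> 'rV[R]_n;
  vcoef_smooth : forall i, smooth (cimg i) (vcoef i);
  vcoef_trans : forall i j u, overlap i j u ->
    vcoef j (ctrans i j u) = vcoef i u *m 'J (ctrans i j) u }.

Record riemannian (R : realType) n (M : manifold R n) := Riemannian {
  rmetric :> metric M;
  rmetric_posdef : forall i u, cimg i u ->
    forall v, v != 0 -> 0 < qform (rmetric i u) v }.

(* The index of a symmetric bilinear form is the largest dimension of a
   subspace (here the row space of [W]) on which it is negative definite. *)
Definition negdef_on (R : realType) n (G W : 'M[R]_n) : Prop :=
  forall v : 'rV[R]_n, (v <= W)%MS -> v != 0 -> qform G v < 0.

Definition has_index (R : realType) n (G : 'M[R]_n) (k : nat) : Prop :=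
  (exists2 W : 'M[R]_n, negdef_on G W & \rank W = k) /\
  (forall W : 'M[R]_n, negdef_on G W -> (\rank W <= k)%N).

Definition lorentzian (R : realType) n (M : manifold R n) (g : metric M) :
  Prop := forall i u, cimg i u -> has_index (g i u) 1.

(* The time-orientation is the one for which the timelike vector field
   [stime] is future-directed. *)
Record spacetime (R : realType) n := Spacetime {
  smanifold :> manifold R n;
  smetric : metric smanifold;
  smetric_lorentzian : lorentzian smetric;
  stime : vector_field smanifold;
  stime_timelike : forall i u, cimg i u ->
    qform (smetric i u) (stime i u) < 0 }.

Section Curves.
Variables (R : realType) (n : nat) (M : manifold R n).

(* A curve is a total function [c : R -> M] together with its domain [I], an
   open interval; the values of [c] outside [I] are irrelevant. *)
Definition open_interval (I : set R) : Prop :=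
  [/\ open I, is_interval I & I !=set0].

Definition smooth_curve (I : set R) (c : R -> M) : Prop :=
  [/\ open_interval I, (forall t, I t -> {for t, continuous c}) &
      forall i : cindex M, smooth (I `&` c @^-1` cdom i) (cmap i \o c)].

Definition velocity (i : cindex M) (c : R -> M) (t : R) : 'rV[R]_n :=
  derive1 (cmap i \o c) t.

Definition acceleration (i : cindex M) (c : R -> M) (t : R) : 'rV[R]_n :=
  derive1n 2 (cmap i \o c) t.

(* [christoffel g i u k a b] is Gamma^k_{ab} at the point of coordinates [u];
   ['D_('e_a) (g i) u b m] is the partial derivative d_a g_{bm}. *)
Definition christoffel (g : metric M) (i : cindex M) (u : 'rV[R]_n)
    (k a b : 'I_n) : R :=
  2^-1 * \sum_(m < n) invmx (g i u) k m *
    ('D_('e_a) (g i) u b m + 'D_('e_b) (g i) u a m - 'D_('e_m) (g i) u a b).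

Definition geodesic_on (g : metric M) (I : set R) (c : R -> M) : Prop :=
  smooth_curve I c /\
  forall (i : cindex M) t, I t -> cdom i (c t) -> forall k : 'I_n,
    acceleration i c t 0 k +
    \sum_(a < n) \sum_(b < n) christoffel g i (cmap i (c t)) k a b *
      velocity i c t 0 a * velocity i c t 0 b = 0.

Definition geodesic (g : metric M) (I : set R) (c : R -> M) : Prop :=
  geodesic_on g I c /\
  forall (J : set R) (d : R -> M), geodesic_on g J d ->
    I `<=` J -> (forall t, I t -> d t = c t) -> J = I.

Definition geodesically_complete (g : metric M) : Prop :=
  forall I c, geodesic g I c -> I = setT.

Definition velocity_sq (g : metric M) (i : cindex M) (c : R -> M) (t : R) : R :=
  qform (g i (cmap i (c t))) (velocity i c t).

Definition nonconstant (I : set R) (c : R -> M) : Prop :=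
  exists s t, [/\ I s, I t & c s <> c t].

Definition Y_manifold (h : riemannian M) (l : R) (x y : M) : Prop :=
  [/\ 0 < l, geodesically_complete h &
    forall I c, geodesic h I c -> I 0 -> c 0 = x ->
      (forall i, cdom i (c 0) -> velocity_sq h i c 0 = 1) ->
      I l /\ c l = y].

Definition Z_manifold (h : riemannian M) (x y : M) : Prop :=
  geodesically_complete h /\
  forall I c, geodesic h I c -> nonconstant I c -> I 0 -> c 0 = x ->
    exists t, [/\ 0 < t, I t & c t = y].

Definition timelike_curve (g : metric M) (I : set R) (c : R -> M) : Prop :=
  smooth_curve I c /\
  forall t, I t -> forall i, cdom i (c t) -> velocity_sq g i c t < 0.

Definition null_geodesic (g : metric M) (I : set R) (c : R -> M) : Prop :=
  geodesic g I c /\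
  forall t, I t -> forall i, cdom i (c t) ->
    velocity i c t != 0 /\ velocity_sq g i c t = 0.

End Curves.

Section Spacetimes.
Variables (R : realType) (n : nat) (X : spacetime R n).

Definition future_null_geodesic (I : set R) (c : R -> X) : Prop :=
  null_geodesic (smetric X) I c /\
  forall t, I t -> forall i, cdom i (c t) ->
    bform (smetric X i (cmap i (c t))) (velocity i c t)
          (stime X i (cmap i (c t))) < 0.

Definition strongly_refocusing (p q : X) : Prop :=
  p <> q /\
  forall I c, null_geodesic (smetric X) I c ->
    (exists2 s, I s & c s = p) -> exists2 t, I t & c t = q.

Definition observer_refocusing (p : X) (J : set R) (d : R -> X) : Prop :=
  timelike_curve (smetric X) J d /\
  forall I c, future_null_geodesic I c -> I 0 -> c 0 = p ->
    exists t, [/\ 0 < t, I t & (d @` J) (c t)].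

End Spacetimes.

Section Smoothness.
Variable R : realType.
Implicit Types V W : normedModType R.

Lemma near_eq_differentiable V W (f g : V -> W) (u : V) :
  (\near u, f u = g u) -> differentiable f u -> differentiable g u.
Proof.
move=> fg df.
have h0 : ((g - f) \o shift u : V -> W) = cst ((g - f) u) + 0 +o_ 0 id.
  apply/eqaddoP => _/posnumP[e].
  have : \forall x \near 0 : V, f (x + u) = g (x + u).
    by have := fg; rewrite (near_shift 0) /= subr0.
  apply: filterS => x fgx /=.
  rewrite !fctE /= fgx (nbhs_singleton fg) !subrr addr0 subr0 normr0.
  by rewrite mulr_ge0.
have c0 : continuous (0 : V -> W) by move=> z; exact: cst_continuous.
have dh : differentiable (g - f) u.
  apply/diff_locallyP; split.
    by rewrite (diff_unique c0 h0).
  by rewrite (diff_unique c0 h0).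
have -> : g = f + (g - f) by apply/funext => z; rewrite !fctE addrC subrK.
exact: differentiableD.
Qed.

Lemma Ck_ext V W k (U : set V) (f g : V -> W) : open U ->
  (forall u, U u -> f u = g u) -> Ck k U f -> Ck k U g.
Proof.
move=> oU; elim: k f g => [|k IH] f g fg /=.
  move=> Cf u Uu; rewrite /prop_for /continuous_at -(fg u Uu).
  apply: cvg_trans (Cf u Uu); apply: near_eq_cvg.
  by apply: filterS (open_nbhs_nbhs (conj oU Uu)) => z Uz; rewrite fg.
have nfg u : U u -> \near u, f u = g u.
  by move=> Uu; apply: filterS (open_nbhs_nbhs (conj oU Uu)) => z Uz; exact: fg.
move=> [df Df]; split=> [u Uu|v].
  exact: near_eq_differentiable (nfg u Uu) (df u Uu).
apply: IH (Df v) => u Uu; exact: near_eq_derive (nfg u Uu).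
Qed.

Lemma Ck_sub V W k (U U' : set V) (f : V -> W) :
  U `<=` U' -> Ck k U' f -> Ck k U f.
Proof.
move=> UU'; elim: k f => [|k IH] f /= => [cf u /UU'/cf //|[df Df]].
by split=> [u /UU'/df //|v]; exact: IH.
Qed.

Lemma Ck_cst V W k (U : set V) (a : W) : Ck k U (cst a).
Proof.
elim: k a => [|k IH] a /=; first by move=> u _; exact: cst_continuous.
split=> [u _|v]; first exact: differentiable_cst.
rewrite (_ : (fun _ => _) = cst 0) //.
by apply/funext => u; rewrite derive_cst.
Qed.

Lemma Ck_add V W k (U : set V) (f g : V -> W) : open U ->
  Ck k U f -> Ck k U g -> Ck k U (f \+ g).
Proof.
move=> oU; elim: k f g => [|k IH] f g /=.
  by move=> cf cg u Uu; apply: cvgD; [exact: cf|exact: cg].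
move=> [df Df] [dg Dg]; split=> [u Uu|v].
  by apply: differentiableD; [exact: df|exact: dg].
apply: Ck_ext (IH _ _ (Df v) (Dg v)) => // u Uu /=.
by rewrite deriveD //; apply: diff_derivable; [exact: df|exact: dg].
Qed.

Lemma derive_lin_comp (V V' W W' : normedModType R) (f : V' -> W')
    (L : {linear V -> V'}) (P : {linear W' -> W}) u v :
  continuous L -> continuous P -> differentiable f (L u) ->
  differentiable (P \o f \o L) u /\
  'D_v (P \o f \o L) u = P ('D_(L v) f (L u)).
Proof.
move=> cL cP df.
have dL : differentiable L u by exact: linear_differentiable.
have dP : differentiable P (f (L u)) by exact: linear_differentiable.
have dPf : differentiable (P \o f) (L u) by exact: differentiable_comp.
have dPfL : differentiable (P \o f \o L) u by exact: differentiable_comp.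
split=> //.
rewrite !deriveE // diff_comp // diff_comp //=.
by rewrite !diff_lin.
Qed.

Lemma Ck_lin_comp (V V' W W' : normedModType R) k (U : set V) (U' : set V')
    (f : V' -> W') (L : {linear V -> V'}) (P : {linear W' -> W}) :
  open U -> (forall u, U u -> U' (L u)) -> continuous L -> continuous P ->
  Ck k U' f -> Ck k U (P \o f \o L).
Proof.
move=> oU UU' cL cP; elim: k f => [|k IH] f /=.
  move=> cf u Uu.
  apply: (@continuous_comp _ _ _ L (P \o f)); first exact: cL.
  by apply: continuous_comp; [exact/cf/UU'|exact: cP].
move=> [df Df]; split=> [u Uu|v].
  exact: (derive_lin_comp 0 cL cP (df _ (UU' _ Uu))).1.
apply: Ck_ext (IH _ (Df (L v))) => // u Uu /=.
by rewrite (derive_lin_comp v cL cP (df _ (UU' _ Uu))).2.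
Qed.

Lemma Ck_linear V W k (U : set V) (L : {linear V -> W}) :
  continuous L -> Ck k U L.
Proof.
move=> cL; case: k => [|k] /=; first by move=> u _; exact: cL.
split=> [u _|v]; first exact: linear_differentiable.
rewrite (_ : (fun _ => _) = cst (L v)); first exact: Ck_cst.
apply/funext => u; rewrite deriveE ?diff_lin //.
exact: linear_differentiable.
Qed.

Lemma mx_linear_continuous m n W (L : {linear 'M[R]_(m, n) -> W}) :
  continuous L.
Proof.
have -> : (L : _ -> W) =
    (fun A : 'M[R]_(m, n) => \sum_i \sum_j A i j *: L (delta_mx i j)).
  apply/funext => A; rewrite {1}[A]matrix_sum_delta linear_sum.
  apply: eq_bigr => i _; rewrite linear_sum; apply: eq_bigr => j _.
  by rewrite linearZ.
apply: continuous_big => [|i _]; first exact: add_continuous.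
apply: continuous_big => [|j _]; first exact: add_continuous.
have cij := @coord_continuous R m n i j.
move=> A; exact: (cvgZr_tmp (cij A)).
Qed.

End Smoothness.

Section ProductTopology.
Variables (T U : topologicalType).

Lemma prod_hausdorff : hausdorff_space T -> hausdorff_space U ->
  hausdorff_space (T * U)%type.
Proof.
move=> hT hU [p1 p2] [q1 q2] clpq; congr (_, _).
  apply: hT => A B /= pA qB.
  have [[x1 x2] [/= [Ax _] [Bx _]]] := clpq (A `*` setT) (B `*` setT)
    (ltac:(exists (A, setT); [split => //; exact: filterT|by []]))
    (ltac:(exists (B, setT); [split => //; exact: filterT|by []])).
  by exists x1.
apply: hU => A B /= pA qB.
have [[x1 x2] [/= [_ Ax] [_ Bx]]] := clpq (setT `*` A) (setT `*` B)
    (ltac:(exists (setT, A); [split => //; exact: filterT|by []]))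
    (ltac:(exists (setT, B); [split => //; exact: filterT|by []])).
by exists x2.
Qed.

Lemma open_setX (A : set T) (B : set U) : open A -> open B -> open (A `*` B).
Proof.
move=> oA oB; rewrite openE => -[a b] [/= Aa Bb].
by exists (A, B) => //; split; exact: open_nbhs_nbhs.
Qed.

Lemma prod_second_countable : @second_countable T -> @second_countable U ->
  @second_countable (T * U)%type.
Proof.
move=> [A cA [oA bA]] [B cB [oB bB]].
exists ((fun p : set T * set U => p.1 `*` p.2) @` (A `*` B)).
  by apply: (sub_countable (card_image_le _ _)); exact: countableX.
split=> [_ [[a b] [/= Aa Bb] <-]|]; first exact: open_setX (oA _ Aa) (oB _ Bb).
move=> [x y] C [[/= P Q] [nP nQ] PQC].
have [a [Aa ax] aP] := bA x P nP.
have [b [Bb yb] bQ] := bB y Q nQ.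
exists (a `*` b); first by split=> //; exists (a, b).
by move=> [z w] [/= az bw]; apply: PQC; split; [exact: aP|exact: bQ].
Qed.

Lemma prod_connected : connected [set: T] -> connected [set: U] ->
  connected [set: T * U].
Proof.
move=> cT cU.
have [-> |/set0P[[x0 y0] _]] := eqVneq [set: T * U] set0.
  exact: connected0.
have fibT y : connected [set p : T * U | p.2 = y].
  have -> : [set p : T * U | p.2 = y] = (fun x => (x, y)) @` setT.
    by apply/seteqP; split=> [[a b] /= <-|_ [x _ <-]//]; exists a.
  apply: connected_continuous_connected => //.
  apply: continuous_subspaceT => x; apply: cvg_pair; [exact: cvg_id|exact: cvg_cst].
have fibU x : connected [set p : T * U | p.1 = x].
  have -> : [set p : T * U | p.1 = x] = (fun y => (x, y)) @` setT.
    by apply/seteqP; split=> [[a b] /= <-|_ [y _ <-]//]; exists b.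
  apply: connected_continuous_connected => //.
  apply: continuous_subspaceT => y; apply: cvg_pair; [exact: cvg_cst|exact: cvg_id].
have -> : [set: T * U] =
    \bigcup_(x in [set: T]) ([set p | p.2 = y0] `|` [set p | p.1 = x]).
  by apply/seteqP; split=> // -[a b] _; exists a => //; right.
apply: bigcup_connected => [|x _].
  by exists (x0, y0) => x _; left.
by apply: connectedU => //; exists (x, y0).
Qed.

End ProductTopology.

Lemma real_second_countable (R : realType) : @second_countable R.
Proof.
exists ((fun p : rat * rat => [set` `]ratr p.1, (ratr p.2 : R)[]) @` setT).
  by apply: (sub_countable (card_image_le _ _)); exact: countableP.
split=> [_ [p _ <-]|x A]; first exact: interval_open.
move=> /nbhs_ballP[e /= e0 eA].
have /rat_in_itvoo[p /itvP xp] : x - e < x by rewrite gtrBl.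
have /rat_in_itvoo[q /itvP xq] : x < x + e by rewrite ltrDl.
exists [set` `]ratr p, (ratr q : R)[].
  by split; [exists (p, q)|rewrite /= in_itv /= xp xq].
move=> z /=; rewrite in_itv /= => /andP[pz zq]; apply: eA.
rewrite /ball /= ltr_distlC (lt_trans _ pz) ?xp // (lt_trans zq) //.
by rewrite xq.
Qed.

Lemma real_connected (R : realType) : connected [set: R].
Proof. by apply/connected_intervalP. Qed.

Section TimesR.
Variables (R : realType) (n : nat).

Lemma row_mx_mulE m (a : 'M[R]_(m, n)) (b : 'M[R]_(m, 1)) :
  row_mx a b = a *m row_mx 1%:M 0 + b *m row_mx 0 1%:M.
Proof. by rewrite !mul_mx_row !mulmx1 !mulmx0 add_row_mx addr0 add0r. Qed.

Lemma block_mx_mulE (A : 'M[R]_n) (d : 'M[R]_1) :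
  block_mx A 0 0 d =
    (mulmx (col_mx 1%:M 0 : 'M[R]_(n + 1, n)) \o mulmxr (row_mx 1%:M 0)) A +
    block_mx 0 0 0 d.
Proof.
rewrite /= mul_mx_row mulmx1 mulmx0 mul_col_mx mul1mx mul0mx.
by rewrite -row_mx0 -/(block_mx _ _ _ _) add_block_mx !addr0 add0r.
Qed.

Variable M : manifold R n.

Definition timesR_dom (i : cindex M) : set (M * R) := cdom i `*` setT.

Definition timesR_map (i : cindex M) (p : M * R) : 'rV[R]_(n + 1) :=
  row_mx (cmap i p.1) (p.2)%:M.

Definition timesR_inv (i : cindex M) (u : 'rV[R]_(n + 1)) : M * R :=
  (cinv i (lsubmx u), rsubmx u 0 0).

Lemma timesR_image i (A : set M) :
  timesR_map i @` (A `*` setT) = lsubmx @^-1` (cmap i @` A).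
Proof.
apply/seteqP; split=> [_ [[a r] [/= Aa _] <-]|u [a Aa /= au]].
  by rewrite /= row_mxKl; exists a.
exists (a, rsubmx u 0 0) => //.
by rewrite /timesR_map /= -mx11_scalar au hsubmxK.
Qed.

Lemma timesR_dom_open i : open (timesR_dom i).
Proof. by apply: open_setX; [exact: cdom_open|exact: openT]. Qed.

Lemma open_lsubmx (A : set 'rV[R]_n) : open A ->
  open (lsubmx @^-1` A : set 'rV[R]_(n + 1)).
Proof.
move=> oA; apply: open_comp => // u _; exact: continuous_lsubmx.
Qed.

Lemma timesR_img_open i : open (timesR_map i @` timesR_dom i).
Proof. by rewrite timesR_image; apply: open_lsubmx; exact: cimg_open. Qed.

Lemma timesR_mapK i p : timesR_dom i p -> timesR_inv i (timesR_map i p) = p.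
Proof.
case: p => a r [/= ia _].
by rewrite /timesR_inv /timesR_map row_mxKl row_mxKr /= cmapK // mxE eqxx.
Qed.

Lemma timesR_map_continuous i p :
  timesR_dom i p -> {for p, continuous (timesR_map i)}.
Proof.
case: p => a r [/= ia _]; rewrite /prop_for /continuous_at.
have -> : timesR_map i = (fun p => mulmxr (row_mx 1%:M 0) (cmap i p.1) +
    mulmxr (row_mx 0 1%:M) (p.2 *: 1%:M)).
  by apply/funext => p; rewrite /= -row_mx_mulE scalemx1.
apply: cvgD.
  apply: (@continuous_comp _ _ _ (cmap i \o fst)
    (mulmxr (row_mx 1%:M 0)) (a, r)); last exact: mx_linear_continuous.
  apply: continuous_comp; first exact: cvg_fst.
  exact: (cmap_continuous ia).
apply: (@continuous_comp _ _ _ (fun p : M * R => p.2 *: (1%:M : 'M[R]_1))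
    (mulmxr (row_mx 0 1%:M)) (a, r)); last exact: mx_linear_continuous.
by apply: cvgZr_tmp; exact: cvg_snd.
Qed.

Lemma timesR_inv_continuous i u :
  (timesR_map i @` timesR_dom i) u -> {for u, continuous (timesR_inv i)}.
Proof.
rewrite timesR_image => iu.
have c1 : {for u, continuous (cinv i \o lsubmx)}.
  apply: continuous_comp; first exact: continuous_lsubmx.
  exact: (cinv_continuous iu).
have c2 : {for u, continuous ((fun A : 'M[R]_1 => A 0 0) \o rsubmx)}.
  apply: continuous_comp; first exact: continuous_rsubmx.
  have c00 := @coord_continuous R 1 1 0 0; exact: c00.
exact: cvg_pair c1 c2.
Qed.

Lemma timesR_cover p : exists i, timesR_dom i p.
Proof. by have [i ip] := cdom_cover p.1; exists i. Qed.

Lemma timesR_transE i j : timesR_map j \o timesR_inv i =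
  (mulmxr (row_mx 1%:M 0) \o ctrans i j \o lsubmx) \+
  (mulmxr (row_mx 0 1%:M) \o rsubmx).
Proof.
apply/funext => u /=.
by rewrite /timesR_map /timesR_inv /= -mx11_scalar row_mx_mulE.
Qed.

Lemma timesR_overlapE i j : timesR_map i @` (timesR_dom i `&` timesR_dom j) =
  lsubmx @^-1` (overlap i j).
Proof. by rewrite /timesR_dom -setXI setIT timesR_image. Qed.

Lemma overlap_open (i j : cindex M) : open (overlap i j).
Proof.
have -> : overlap i j = cimg i `&` cinv i @^-1` (cdom j).
  apply/seteqP; split=> [_ [p [ip jp] <-]|_ [[p ip <-] /=]].
    by split; [exists p|rewrite /= cmapK].
  by rewrite cmapK // => jp; exists p.
rewrite openE => u [iu ju].
have nj : nbhs u (cinv i @^-1` cdom j).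
  exact: cinv_continuous iu _ (open_nbhs_nbhs (conj (cdom_open j) ju)).
have ni : nbhs u (cimg i).
  by apply: open_nbhs_nbhs; split=> //; exact: cimg_open.
exact: filterI ni nj.
Qed.

Lemma timesR_trans_smooth i j :
  smooth (timesR_map i @` (timesR_dom i `&` timesR_dom j))
    (timesR_map j \o timesR_inv i).
Proof.
move=> k; rewrite timesR_overlapE timesR_transE.
have oO := open_lsubmx (@overlap_open i j).
apply: Ck_add => //.
  apply: (Ck_lin_comp oO (U' := overlap i j)) => //; try exact: mx_linear_continuous.
  exact: ctrans_smooth.
apply: (@Ck_linear _ _ _ _ _ (mulmxr (row_mx 0 1%:M) \o rsubmx)).
exact: mx_linear_continuous.
Qed.

Definition timesR : manifold R (n + 1) :=
  Manifold (prod_hausdorff (@mspace_hausdorff _ _ M) (@Rhausdorff R))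
    (prod_second_countable (@mspace_second_countable _ _ M)
       (@real_second_countable R))
    (prod_connected (@mspace_connected _ _ M) (@real_connected R))
    timesR_dom_open timesR_img_open timesR_mapK timesR_map_continuous
    timesR_inv_continuous timesR_cover timesR_trans_smooth.

Lemma timesR_jacobian (i j : cindex timesR) u : overlap i j u ->
  'J (ctrans i j) u = block_mx ('J (ctrans (i : cindex M) j) (lsubmx u)) 0 0 1%:M.
Proof.
rewrite /overlap timesR_overlapE => /= iju.
have dF : differentiable (ctrans i j) u.
  have := @timesR_trans_smooth i j 1; rewrite timesR_overlapE => -[dF _].
  exact: dF.
have dt : differentiable (ctrans (i : cindex M) j) (lsubmx u).
  have := @ctrans_smooth _ _ M i j 1%N => -[dF' _]; exact: dF'.
have c1 m p (L : {linear 'rV[R]_m -> 'rV[R]_p}) : continuous L.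
  exact: mx_linear_continuous.
have H (v : 'rV[R]_(n + 1)) : v *m 'J (ctrans i j) u =
   v *m block_mx ('J (ctrans (i : cindex M) j) (lsubmx u)) 0 0 1%:M.
  rewrite -(deriveEjacobian v dF) /ctrans /= timesR_transE.
  pose L1 : {linear 'rV[R]_(n + 1) -> 'rV[R]_n} := lsubmx.
  pose P1 : {linear 'rV[R]_n -> 'rV[R]_(n + 1)} := mulmxr (row_mx 1%:M 0).
  have [d1 D1] := @derive_lin_comp R _ _ _ _ (ctrans (i : cindex M) j) L1 P1 u v
    (c1 _ _ L1) (c1 _ _ P1) dt.
  pose L2 : {linear 'rV[R]_(n + 1) -> 'rV[R]_(n + 1)} :=
    mulmxr (row_mx 0 1%:M) \o rsubmx.
  have d2 : differentiable L2 u by exact: linear_differentiable (c1 _ _ L2).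
  rewrite deriveD; [|exact: diff_derivable..].
  rewrite D1 (deriveE v d2) (diff_lin u (c1 _ _ L2)).
  rewrite /= deriveEjacobian // -row_mx_mulE.
  rewrite -[in RHS](hsubmxK v) mul_row_block !mulmx0 addr0 add0r.
  by rewrite mulmx1.
by apply/row_matrixP => k; rewrite !rowE H.
Qed.

End TimesR.

Section AssociatedSpacetime.
Variables (R : realType) (n : nat) (M : manifold R n) (h : riemannian M).

Definition product_mcoef (i : cindex (timesR M)) (u : 'rV[R]_(n + 1)) :
    'M[R]_(n + 1) :=
  block_mx (h i (lsubmx u)) 0 0 (- 1%:M).

Lemma timesR_cimg (i : cindex (timesR M)) u :
  cimg i u -> cimg (i : cindex M) (lsubmx u).
Proof. by rewrite /cimg timesR_image. Qed.

Lemma product_mcoef_smooth i : smooth (cimg i) (product_mcoef i).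
Proof.
move=> k; rewrite /cimg timesR_image.
have oO := open_lsubmx (@cimg_open _ _ M i).
have -> : product_mcoef i =
  ((mulmx (col_mx 1%:M 0 : 'M[R]_(n + 1, n)) \o mulmxr (row_mx 1%:M 0)) \o
    h i \o lsubmx) \+ cst (block_mx 0 0 0 (- 1%:M)).
  by apply/funext => u; rewrite /product_mcoef block_mx_mulE.
apply: Ck_add => //; last exact: Ck_cst.
apply: (Ck_lin_comp oO (U' := cimg (i : cindex M))
  (P := mulmx (col_mx 1%:M 0 : 'M[R]_(n + 1, n)) \o mulmxr (row_mx 1%:M 0))) => //;
  try exact: mx_linear_continuous.
exact: mcoef_smooth.
Qed.

Lemma product_mcoef_sym i u :
  cimg i u -> (product_mcoef i u)^T = product_mcoef i u.
Proof.
move=> /timesR_cimg iu.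
by rewrite /product_mcoef tr_block_mx !trmx0 mcoef_sym // linearN /= trmx1.
Qed.

Lemma product_mcoef_nondegenerate i u :
  cimg i u -> product_mcoef i u \in unitmx.
Proof.
move=> /timesR_cimg iu.
rewrite unitmxE /product_mcoef det_ublock unitrM -!unitmxE.
by rewrite mcoef_nondegenerate //= unitmxE -scaleN1r detZ det1 mulr1 expr1 unitrN1.
Qed.

Lemma product_mcoef_trans i j u : overlap i j u ->
  product_mcoef i u = 'J (ctrans i j) u *m product_mcoef j (ctrans i j u) *m
    ('J (ctrans i j) u)^T.
Proof.
move=> iju; rewrite timesR_jacobian // /product_mcoef.
have iju' : overlap (i : cindex M) j (lsubmx u).
  by move: iju; rewrite /overlap timesR_overlapE.
rewrite tr_block_mx !mulmx_block !trmx0 trmx1.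
rewrite !(mul0mx, mulmx0, mul1mx, mulmx1, addr0, add0r).
by rewrite (mcoef_trans h iju') /ctrans /= row_mxKl.
Qed.

Definition product_metric : metric (timesR M) :=
  Metric product_mcoef_smooth product_mcoef_sym product_mcoef_nondegenerate
    product_mcoef_trans.

Lemma product_qform (A : 'M[R]_n) (v : 'rV[R]_(n + 1)) :
  qform (block_mx A 0 0 (- 1%:M)) v =
    qform A (lsubmx v) - (rsubmx v 0 0) ^+ 2.
Proof.
rewrite /qform /bform -{1 2}(hsubmxK v) mul_row_block !mulmx0 addr0 add0r.
rewrite tr_row_mx mul_row_col mulmxN mulmx1 mulNmx [LHS]mxE; congr (_ + _).
by rewrite !mxE big_ord1 !mxE expr2.
Qed.

Lemma product_lorentzian : lorentzian product_metric.
Proof.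
move=> i u /timesR_cimg iu; have hpos := rmetric_posdef h iu.
split=> [|W Wneg].
  pose e : 'rV[R]_(n + 1) := row_mx 0 1%:M.
  exists <<e>>%MS; last first.
    rewrite mxrank_gen rank_rV; apply/eqP; rewrite eqb1; apply/eqP => /rowP e0.
    by move: (e0 (rshift n 0)); rewrite /e row_mxEr !mxE eqxx => /eqP; rewrite oner_eq0.
  move=> v; rewrite genmxE => /sub_rVP[a ->] ae0; rewrite product_qform.
  have a0 : a != 0 by apply: contra_neq ae0 => ->; rewrite scale0r.
  rewrite /e scale_row_mx row_mxKl row_mxKr scaler0 /qform /bform !mul0mx.
  by rewrite !mxE eqxx mulr1 sub0r oppr_lt0 exprn_even_gt0.
pose P : 'M[R]_(n + 1, 1) := col_mx 0 1%:M.
rewrite leqNgt; apply/negP => rW.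
have kW0 : (W :&: kermx P)%MS != 0.
  rewrite -mxrank_eq0 -lt0n -(ltn_add2l (\rank (W *m P))) mxrank_mul_ker addn0.
  by apply: leq_ltn_trans rW; exact: rank_leq_col.
have [v vWP v0] := rowV0Pn kW0.
move: vWP; rewrite sub_capmx => /andP[vW /sub_kermxP vP].
have := Wneg v vW v0.
rewrite product_qform.
have rv0 : rsubmx v = 0.
  by move: vP; rewrite -{1}(hsubmxK v) mul_row_col mulmx0 mulmx1 add0r.
rewrite rv0 mxE expr0n subr0 ltNge => /negP; apply.
have [->|lv0] := eqVneq (lsubmx v) 0; last exact/ltW/hpos.
by rewrite /qform /bform !mul0mx mxE.
Qed.

Definition product_time (i : cindex (timesR M)) (u : 'rV[R]_(n + 1)) :
  'rV[R]_(n + 1) := row_mx 0 1%:M.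

Lemma product_time_smooth i : smooth (cimg i) (product_time i).
Proof. by move=> k; exact (@Ck_cst R _ _ k (cimg i) (row_mx 0 1%:M)). Qed.

Lemma product_time_trans i j u : overlap i j u ->
  product_time j (ctrans i j u) = product_time i u *m 'J (ctrans i j) u.
Proof.
move=> iju; rewrite timesR_jacobian // /product_time mul_row_block.
by rewrite !(mul0mx, mulmx0, mulmx1, addr0, add0r).
Qed.

Definition product_time_field : vector_field (timesR M) :=
  VectorField product_time_smooth product_time_trans.

Lemma product_time_timelike i u : cimg i u ->
  qform (product_metric i u) (product_time_field i u) < 0.
Proof.
move=> _; rewrite product_qform /= row_mxKl row_mxKr.
by rewrite /qform /bform !mul0mx !mxE eqxx expr1n sub0r ltrN10.
Qed.

Definition associated_spacetime : spacetime R (n + 1) :=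
  Spacetime product_lorentzian product_time_timelike.

End AssociatedSpacetime.

(* Main.v *)
(* In M x R the Christoffel symbols with an R-index vanish, so a null geodesic is
   a pair of a geodesic of M and an affine function of nonzero slope r, the M-part
   having constant speed |r|.  Its M-part is maximal, hence defined on all of R
   by completeness; reparametrized to unit speed it reaches y at the parameter l
   of Y_l^(x,y), which is when the R-part equals l.  For Z^(x,y) it suffices that
   the M-part reaches y, since gamma sweeps the whole line {y} x R. *)
Require Import Defs.
From HB Require Import structures.
From mathcomp Require Import all_boot all_order all_algebra.
From mathcomp Require Import all_classical all_reals all_analysis.
From mathcomp Require Import ring.
Import Order.TTheory GRing.Theory Num.Theory.
Import numFieldNormedType.Exports.
Local Open Scope classical_set_scope.
Local Open Scope ring_scope.

Set Implicit Arguments.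
Unset Strict Implicit.
Unset Printing Implicit Defensive.

(** * Calculus of smooth functions of one real variable *)

Section Calculus.
Variable R : realType.
Implicit Types V W : normedModType R.

(** Every clause of [Ck] is a condition at single points, so it can be checked on any cover of [U].
    This glues what is known chart by chart along a curve into a statement on its whole interval. *)
Lemma Ck_local V W k (U : set V) (f : V -> W) :
  (forall u, U u -> exists2 U', U' u & Ck k U' f) -> Ck k U f.
Proof.
elim: k f => [|k IH] f /= Uf.
  by move=> u /Uf[U' U'u cf]; exact: cf.
split=> [u /Uf[U' U'u [df _]]|v]; first exact: df.
by apply: IH => u /Uf[U' U'u [_ Df]]; exists U'.
Qed.

Lemma Ck_post V W W' k (U : set V) (f : V -> W) (P : {linear W -> W'}) :
  open U -> continuous P -> Ck k U f -> Ck k U (P \o f).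
Proof.
move=> oU cP cf.
apply: (Ck_lin_comp (L := (idfun : {linear V -> V})) oU _ _ cP cf) => //.
by move=> x; exact: cvg_id.
Qed.

Lemma derive1_post V W (f : R -> V) (P : {linear V -> W}) t :
  continuous P -> differentiable f t ->
  derive1 (P \o f) t = P (derive1 f t).
Proof.
move=> cP df.
have cid : continuous (idfun : {linear R -> R}) by move=> z; exact: cvg_id.
have [_] := @derive_lin_comp R _ _ _ _ f (idfun : {linear R -> R}) P t 1 cid cP df.
by rewrite !derive1E.
Qed.

Lemma smooth_derive1 V (U : set R) (f : R -> V) t :
  smooth U f -> U t ->
  differentiable f t /\ differentiable (derive1 f) t.
Proof.
move=> /(_ 2%N)[df /(_ 1)[ddf _]] Ut; split; first exact: df.
rewrite (_ : derive1 f = fun u => 'D_1 f u); first exact: ddf.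
by apply/funext => u; rewrite derive1E.
Qed.

Lemma derive1n2_post V W (U : set R) (f : R -> V) (P : {linear V -> W}) t :
  open U -> U t -> smooth U f -> continuous P ->
  derive1n 2 (P \o f) t = P (derive1n 2 f t).
Proof.
move=> oU Ut sf cP.
rewrite /derive1n /= -derive1_post //; last exact: (smooth_derive1 sf Ut).2.
(* The formula for the first derivative is available on [U] only, which is a neighbourhood of [t];
   hence the comparison of germs at [t]. *)
rewrite !derive1E; apply: near_eq_derive.
apply: filterS (open_nbhs_nbhs (conj oU Ut)) => u Uu.
by apply: derive1_post => //; exact: (smooth_derive1 sf Uu).1.
Qed.

Lemma derive_affine V (f : R -> V) (s r t v : R) :
  differentiable f (s + r * t) ->
  differentiable (fun u => f (s + r * u)) t /\
  'D_v (fun u => f (s + r * u)) t = r *: 'D_v f (s + r * t).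
Proof.
move=> df; pose g : R -> R := fun u => s + r * u.
have dg : is_diff t g (fun v => r * v).
  have -> : g = cst s + r *: (id : R -> R) by exact/funext.
  have -> : (fun v : R => r * v) = 0 + r *: (id : R -> R).
    by apply/funext => z; rewrite !fctE add0r.
  have d2 : is_diff t (r *: (id : R -> R)) (r *: (id : R -> R)) by exact: is_diffZ.
  exact: is_diffD.
have dfg : differentiable (f \o g) t by exact: differentiable_comp.
split=> //; rewrite (deriveE _ dfg) deriveE // diff_comp //= diff_val.
by rewrite -linearZ.
Qed.

(** The affine counterpart of [Ck_lin_comp]: by the chain rule a derivative of the composite is [r]
    times a derivative of [f] composed with the same affine map, so the induction on [k] closes. *)
Lemma Ck_affine V k (U U' : set R) (f : R -> V) (s r : R) : open U ->
  (forall t, U t -> U' (s + r * t)) -> Ck k U' f ->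
  Ck k U (fun t => f (s + r * t)).
Proof.
move=> oU UU'; elim: k f => [|k IH] f /=.
  move=> cf u Uu.
  apply: (@continuous_comp _ _ _ (fun u : R => s + r * u) f); last exact/cf/UU'.
  by apply: cvgD; [exact: cvg_cst|apply: cvgM; [exact: cvg_cst|exact: cvg_id]].
move=> [df Df]; split=> [u /UU' Uu|v].
  exact: (derive_affine 0 (df _ Uu)).1.
apply: (@Ck_ext _ _ _ _ _ (fun t => r *: 'D_v f (s + r * t))) => // [u Uu|].
  by rewrite (derive_affine v (df _ (UU' _ Uu))).2.
apply: (@Ck_post _ _ _ _ _ (fun t => 'D_v f (s + r * t)) ( *:%R r)) => //.
  by move=> x; exact: scaler_continuous.
exact: (IH (fun u => 'D_v f u)).
Qed.

Lemma derive1_affine V (f : R -> V) (s r t : R) :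
  differentiable f (s + r * t) ->
  derive1 (fun u => f (s + r * u)) t = r *: derive1 f (s + r * t).
Proof. by move=> df; rewrite !derive1E (derive_affine 1 df).2. Qed.

Lemma derive1n2_affine V (U : set R) (f : R -> V) (s r t : R) :
  open U -> U (s + r * t) -> smooth U f ->
  derive1n 2 (fun u => f (s + r * u)) t = r ^+ 2 *: derive1n 2 f (s + r * t).
Proof.
move=> oU Ut sf; have [df ddf] := smooth_derive1 sf Ut.
rewrite /derive1n /= expr2 -scalerA -derive1_affine //.
have [dd _] := derive_affine 0 ddf.
rewrite -(@derive1_post _ _ (fun u => derive1 f (s + r * u)) ( *:%R r)) //; last first.
  by move=> x; exact: scaler_continuous.
rewrite !derive1E; apply: near_eq_derive.
have cg : {for t, continuous (fun u : R => s + r * u)}.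
  by apply: cvgD; [exact: cvg_cst|apply: cvgM; [exact: cvg_cst|exact: cvg_id]].
have nU : \near t, U (s + r * t) by exact: cg _ (open_nbhs_nbhs (conj oU Ut)).
apply: filterS nU => u /= Uu.
by apply: derive1_affine; exact: (smooth_derive1 sf Uu).1.
Qed.

(** Mean value theorem on the segment between the two points, which stays inside [I]. *)
Lemma constant_on_interval (I : set R) (f : R -> R) : is_interval I ->
  (forall t, I t -> differentiable f t /\ derive1 f t = 0) ->
  forall s t, I s -> I t -> f s = f t.
Proof.
move=> iI df; suff le_eq s t : s <= t -> I s -> I t -> f s = f t.
  by move=> s t Is It; case: (leP s t) => [|/ltW] st; [|symmetry]; exact: le_eq.
move=> st Is It.
have Iu u : u \in `[s, t]%R -> I u.
  by rewrite in_itv /= => sut; exact: (iI s t).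
have [|u ust|u /Iu Iuu E] := @MVT_segment R f (derive1 f) s t st.
- move=> u ust; have {}ust : u \in `[s, t]%R by exact: subset_itv_oo_cc ust.
  have [du _] := df u (Iu _ ust).
  apply: DeriveDef; first exact: diff_derivable.
  by rewrite derive1E.
- apply: continuous_in_subspaceT => // v; rewrite inE /= => /Iu/df[dv _].
  exact: differentiable_continuous.
- by move: E; rewrite (df u Iuu).2 mul0r => /eqP; rewrite subr_eq0 => /eqP.
Qed.

(** Two uses of [constant_on_interval]: first for the derivative of [f], then for [f] minus the
    linear function with slope [derive1 f t0]. It integrates the R-component of the geodesic
    equation. *)
Lemma affine_on_interval (I : set R) (f : R -> R) (t0 : R) :
  open I -> is_interval I -> I t0 -> smooth I f ->
  (forall t, I t -> derive1n 2 f t = 0) ->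
  forall t, I t -> f t = f t0 + derive1 f t0 * (t - t0) /\
                   derive1 f t = derive1 f t0.
Proof.
move=> oI iI It0 sf f2 t It; have sfd := smooth_derive1 sf.
have f1 u : I u -> derive1 f u = derive1 f t0.
  move=> Iu; apply: (constant_on_interval iI) => // v Iv.
  by split; [exact: (sfd _ Iv).2|exact: f2].
split; last exact: f1.
pose g : R -> R := fun u => f u - derive1 f t0 * u.
suff : g t = g t0.
  by rewrite /g mulrBr => E; rewrite addrA addrAC -E subrK.
apply: (constant_on_interval iI) => // u Iu.
have du := (sfd _ Iu).1.
have dl : differentiable (( *:%R (derive1 f t0)) \o (id : R -> R)) u.
  exact: differentiableZ.
have -> : g = f - ( *:%R (derive1 f t0) \o id) by exact/funext.
split; first exact: differentiableB.
rewrite derive1E deriveB ?[in X in _ - X]deriveE //; do ?exact: diff_derivable.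
rewrite -derive1E f1 //.
have cl : continuous ( *:%R (derive1 f t0) : R -> R).
  by move=> x; exact: scaler_continuous.
have := diff_lin u cl => /= ->.
by rewrite /GRing.scale /= mulr1 subrr.
Qed.

End Calculus.

(** * Curves and geodesics of M x R in terms of their two components *)

Lemma chart_preimage_open (R : realType) n (M : manifold R n) (i : cindex M)
    (I : set R) (c : R -> M) :
  open I -> (forall t, I t -> {for t, continuous c}) ->
  open (I `&` c @^-1` cdom i).
Proof.
move=> oI cc; rewrite openE => t [It ct].
apply: filterI; first exact: open_nbhs_nbhs.
by apply: (cc t It); apply: open_nbhs_nbhs; split=> //; exact: cdom_open.
Qed.

Section ProductGeodesics.
Variables (R : realType) (n : nat) (M : manifold R n).

(** The last coordinate, written as the trace of the 1 x 1 right block so that it is a composite of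
    packaged linear maps and [Ck_post] and [derive1_post] apply to it. *)
Definition last_coord : {linear 'rV[R]_(n + 1) -> R^o} :=
  (mxtrace : {linear 'M[R]_1 -> R^o}) \o rsubmx.

Lemma cmap_fst (i : cindex M) (c : R -> timesR M) :
  cmap i \o (fst \o c) = lsubmx \o (cmap (i : cindex (timesR M)) \o c).
Proof. by apply/funext => t /=; rewrite row_mxKl. Qed.

Lemma snd_last_coord (i : cindex (timesR M)) (c : R -> timesR M) :
  snd \o c = last_coord \o (cmap i \o c).
Proof. by apply/funext => t /=; rewrite row_mxKr mxtrace_scalar. Qed.

(** A product chart is a chart of M next to the identity of R. Both components are therefore linear
    images of the chart expression of [c], and that expression is a sum of linear images of the
    components. *)
Lemma smooth_curve_timesR (I : set R) (c : R -> timesR M) :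
  smooth_curve I c <->
    smooth_curve I (fst \o c : R -> M) /\ smooth I (snd \o c : R -> R).
Proof.
have cL : continuous (lsubmx : {linear 'rV[R]_(n + 1) -> 'rV[R]_n}).
  exact: mx_linear_continuous.
have cl : continuous (last_coord : 'rV[R]_(n + 1) -> R).
  exact: mx_linear_continuous.
split=> [[oiI cc sc]|[[oiI ca sa] sb]]; have [oI _ _] := oiI.
  have oU (i : cindex (timesR M)) : open (I `&` c @^-1` cdom i).
    exact: chart_preimage_open.
  have dE (i : cindex M) : (fst \o c) @^-1` cdom i =
      c @^-1` cdom (i : cindex (timesR M)).
    by apply/seteqP; split=> t //= [].
  split; last first.
    (* The R-component is the last coordinate in every chart, so its smoothness on the chart
       preimages glues to all of [I]. *)
    move=> k; apply: Ck_local => t It.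
    have [i ci] := cdom_cover (c t); exists (I `&` c @^-1` cdom i) => //.
    by rewrite (snd_last_coord i); apply: Ck_post => //; exact: sc.
  split=> // [t It|i].
    by apply: (@continuous_comp _ _ _ c fst); [exact: cc|exact: cvg_fst].
  rewrite dE cmap_fst => k.
  exact: (@Ck_post _ _ _ _ k _ _
    (lsubmx : {linear 'rV[R]_(n + 1) -> 'rV[R]_n}) (oU i) cL (sc i k)).
have cb t : I t -> {for t, continuous (snd \o c : R -> R)} := sb 0%N t.
split=> // [t It|i k].
  have -> : c = fun t => ((fst \o c) t, (snd \o c) t).
    by apply/funext => u /=; case: (c u).
  exact: cvg_pair (ca t It) (cb t It).
have dE : c @^-1` cdom (i : cindex (timesR M)) =
    (fst \o c) @^-1` cdom (i : cindex M).
  by apply/seteqP; split=> t //= [].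
have oU : open (I `&` c @^-1` cdom i).
  by rewrite dE; exact: chart_preimage_open.
have -> : cmap i \o c =
    (mulmxr (row_mx 1%:M 0) \o (cmap (i : cindex M) \o (fst \o c))) \+
    ( *:%R^~ (row_mx 0 1%:M) \o (snd \o c)).
  by apply/funext => t /=; rewrite -mul_scalar_mx -row_mx_mulE.
apply: Ck_add => //.
  apply: Ck_post => //; first exact: mx_linear_continuous.
  by rewrite dE; exact: sa.
(* The R-component enters as a multiple of the last basis vector; the map sending a scalar to that
   multiple is packaged as linear to use [Ck_post]. *)
pose e : 'rV[R]_(n + 1) := row_mx 0 1%:M.
have eL : linear ( *:%R^~ e : R^o -> _).
  by move=> r u v; rewrite scalerDl -scalerA.
pose eLM := GRing.isLinear.Build _ _ _ _ _ eL.
pose P : {linear R^o -> 'rV[R]_(n + 1)} := HB.pack ( *:%R^~ e : R^o -> _) eLM.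
have cP : continuous (P : R -> 'rV[R]_(n + 1)).
  by move=> r; apply: cvgZr_tmp; exact: cvg_id.
have sb' : Ck k (I `&` c @^-1` cdom i) (snd \o c : R -> R).
  by apply: Ck_sub (sb k) => t [].
exact: (@Ck_post _ R _ _ k _ _ P oU cP sb').
Qed.

Variable h : riemannian M.

(** The product matrix is a constant plus a linear image of [h] evaluated at the M-coordinates, so
    only the M-block and the M-part of the direction contribute. *)
Lemma derive_product_metric (i : cindex (timesR M)) (u v : 'rV[R]_(n + 1)) :
  cimg i u ->
  'D_v (product_metric h i) u =
    block_mx ('D_(lsubmx v) (h (i : cindex M)) (lsubmx u)) 0 0 0.
Proof.
move=> /timesR_cimg iu.
pose P : {linear 'M[R]_n -> 'M[R]_(n + 1)} :=
  mulmx (col_mx 1%:M 0 : 'M[R]_(n + 1, n)) \o mulmxr (row_mx 1%:M 0).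
have -> : (product_metric h i : _ -> _) =
    (P \o h (i : cindex M) \o (lsubmx : {linear 'rV[R]_(n + 1) -> 'rV[R]_n})) +
    cst (block_mx 0 0 0 (- 1%:M)).
  by apply/funext => w; rewrite /= /product_mcoef block_mx_mulE.
have dh : differentiable (h (i : cindex M)) (lsubmx u).
  by have [dh _] := mcoef_smooth h (i : cindex M) 1; exact: dh.
have [dP DP] := @derive_lin_comp R _ _ _ _ (h (i : cindex M))
  (lsubmx : {linear 'rV[R]_(n + 1) -> 'rV[R]_n}) P u v
  (@mx_linear_continuous _ _ _ _ _) (@mx_linear_continuous _ _ _ _ _) dh.
rewrite deriveD; [|exact: diff_derivable..].
by rewrite DP derive_cst addr0 [RHS]block_mx_mulE block_mx0 addr0.
Qed.

(** The metric is block diagonal, constant in its R-block and independent of the R-coordinate: its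
    partial derivatives vanish as soon as one index is the R-index. Its inverse is block diagonal
    too, so an upper R-index meets only such vanishing derivatives. *)
Lemma christoffel_product (i : cindex (timesR M)) (u : 'rV[R]_(n + 1)) :
  cimg i u ->
  [/\ forall k a b, christoffel (product_metric h) i u
        (lshift 1 k) (lshift 1 a) (lshift 1 b) =
        christoffel h (i : cindex M) (lsubmx u) k a b,
      forall a b, christoffel (product_metric h) i u (rshift n 0) a b = 0,
      forall k b, christoffel (product_metric h) i u k (rshift n 0) b = 0 &
      forall k a, christoffel (product_metric h) i u k a (rshift n 0) = 0].
Proof.
move=> iu.
have [dh dhE] : exists dh, forall v, 'D_v (h (i : cindex M)) (lsubmx u) = dh v.
  by eexists.
have D v : 'D_v (product_metric h i) u = block_mx (dh (lsubmx v)) 0 0 0.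
  by rewrite derive_product_metric // dhE.
have ul (a : 'I_n) : lsubmx ('e_(lshift 1 a) : 'rV[R]_(n + 1)) = 'e_a.
  by apply/rowP => j; rewrite !mxE eq_lshift.
have ur (a : 'I_1) : lsubmx ('e_(rshift n a) : 'rV[R]_(n + 1)) = 0.
  by apply/rowP => j; rewrite !mxE eq_lrshift.
(* The R-direction has M-part 0, where the differential of [h] vanishes by linearity. *)
have D0 : dh 0 = 0.
  rewrite -dhE; have [df _] := mcoef_smooth h (i : cindex M) 1.
  by rewrite deriveE ?linear0 //; exact/df/timesR_cimg.
have I : invmx (product_metric h i u) =
    block_mx (invmx (h (i : cindex M) (lsubmx u))) 0 0 (invmx (- 1%:M)).
  by apply: invmx_block_diag; exact: (mcoef_nondegenerate (product_metric h) iu).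
have bE := (block_mxEul, block_mxEur, block_mxEdl, block_mxEdr).
rewrite /christoffel; move: D I.
move: (mcoef (product_metric h) i) (invmx (h _ _)) (invmx _) => G K L D I.
split=> [k a b|a b|k b|k a].
- rewrite big_split_ord big_ord1 /=.
  rewrite I !D !ul !ur D0 !bE !mxE mul0r addr0; congr (_ * _).
  by apply: eq_bigr => m _; rewrite !dhE !D !ul !bE.
- rewrite big1 ?mulr0 // => m _; rewrite I !D.
  case: (split_ordP m) => m' ->; case: (split_ordP a) => a' ->;
    case: (split_ordP b) => b' ->;
    by rewrite ?ul ?ur ?D0 ?block_mx0 !bE ?mxE ?subr0 ?addr0 ?(mul0r, mulr0).
- rewrite big1 ?mulr0 // => m _; rewrite I !D.
  case: (split_ordP m) => m' ->; case: (split_ordP k) => k' ->;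
    case: (split_ordP b) => b' ->;
    by rewrite ?ul ?ur ?D0 ?block_mx0 !bE ?mxE ?subr0 ?addr0 ?(mul0r, mulr0).
- rewrite big1 ?mulr0 // => m _; rewrite I !D.
  case: (split_ordP m) => m' ->; case: (split_ordP k) => k' ->;
    case: (split_ordP a) => a' ->;
    by rewrite ?ul ?ur ?D0 ?block_mx0 !bE ?mxE ?subr0 ?addr0 ?(mul0r, mulr0).
Qed.

Lemma last_coordE (u : 'rV[R]_(n + 1)) : last_coord u = u 0 (rshift n 0).
Proof. by rewrite /= /mxtrace big_ord1 mxE. Qed.

Section CurveComponents.
Variables (I : set R) (c : R -> timesR M).
Hypothesis sc : smooth_curve I c.
Variables (i : cindex (timesR M)) (t : R).
Hypotheses (It : I t) (ct : cdom i (c t)).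

Let L : {linear 'rV[R]_(n + 1) -> 'rV[R]_n} := lsubmx.

Let cL : continuous L. Proof. exact: mx_linear_continuous. Qed.

Let cl : continuous (last_coord : 'rV[R]_(n + 1) -> R).
Proof. exact: mx_linear_continuous. Qed.

Let oU : open (I `&` c @^-1` cdom i).
Proof. by have [[oI _ _] cc _] := sc; exact: chart_preimage_open. Qed.

Let sU : smooth (I `&` c @^-1` cdom i) (cmap i \o c).
Proof. by have [_ _] := sc; exact. Qed.

(** Projections are linear in product charts, hence commute with differentiation; the same reason
    serves for accelerations and for the R-component. *)
Lemma velocity_fst :
  velocity (i : cindex M) (fst \o c) t = lsubmx (velocity i c t).
Proof.
rewrite /velocity cmap_fst; apply: (@derive1_post _ _ _ _ L) => //.
by have [] := smooth_derive1 sU (conj It ct).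
Qed.

Lemma acceleration_fst :
  acceleration (i : cindex M) (fst \o c) t = lsubmx (acceleration i c t).
Proof.
rewrite /acceleration cmap_fst.
exact: (@derive1n2_post _ _ _ _ _ L _ oU (conj It ct) sU cL).
Qed.

Lemma velocity_snd : derive1 (snd \o c : R -> R) t = velocity i c t 0 (rshift n 0).
Proof.
rewrite -last_coordE (snd_last_coord i).
apply: (@derive1_post _ _ _ _ last_coord) => //.
by have [] := smooth_derive1 sU (conj It ct).
Qed.

Lemma acceleration_snd :
  derive1n 2 (snd \o c : R -> R) t = acceleration i c t 0 (rshift n 0).
Proof.
rewrite -last_coordE (snd_last_coord i).
exact: (@derive1n2_post _ _ _ _ _ last_coord _ oU (conj It ct) sU cl).
Qed.

Lemma velocity_sq_product :
  velocity_sq (product_metric h) i c t =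
  velocity_sq h (i : cindex M) (fst \o c) t - derive1 (snd \o c : R -> R) t ^+ 2.
Proof.
rewrite /velocity_sq velocity_fst velocity_snd product_qform row_mxKl.
by rewrite [in LHS]mxE.
Qed.

End CurveComponents.

(** The geodesic system decouples by [christoffel_product]: the equations with an M-index are those
    of the M-component, and the one with the R-index loses its quadratic term. *)
Lemma geodesic_on_product (I : set R) (c : R -> timesR M) :
  geodesic_on (product_metric h) I c <->
  [/\ geodesic_on h I (fst \o c : R -> M), smooth I (snd \o c : R -> R) &
      forall t, I t -> derive1n 2 (snd \o c : R -> R) t = 0].
Proof.
have im (i : cindex (timesR M)) t : cdom i (c t) -> cimg i (cmap i (c t)).
  by move=> ct; exists (c t).
(* For an M-index the left-hand sides of the two geodesic equations coincide; this serves both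
   directions of the equivalence. *)
have E (sc : smooth_curve I c) (i : cindex (timesR M)) t (It : I t)
    (ct : cdom i (c t)) (k : 'I_n) :
    acceleration i c t 0 (lshift 1 k) +
    \sum_(a < n + 1) \sum_(b < n + 1)
      christoffel (product_metric h) i (cmap i (c t)) (lshift 1 k) a b *
      velocity i c t 0 a * velocity i c t 0 b =
    acceleration (i : cindex M) (fst \o c) t 0 k +
    \sum_(a < n) \sum_(b < n)
      christoffel h (i : cindex M) (cmap (i : cindex M) (c t).1) k a b *
      velocity (i : cindex M) (fst \o c) t 0 a *
      velocity (i : cindex M) (fst \o c) t 0 b.
  have [C1 _ C2 C3] := christoffel_product (im i t ct).
  rewrite (acceleration_fst sc It ct) (velocity_fst sc It ct) mxE.
  congr (_ + _); rewrite big_split_ord /= big_ord1.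
  rewrite [X in _ + X]big1 ?addr0 => [|b _]; last by rewrite C2 !mul0r.
  apply: eq_bigr => a _; rewrite big_split_ord /= big_ord1 C3 !mul0r addr0.
  by apply: eq_bigr => b _; rewrite C1 row_mxKl !mxE.
split=> [[sc gc]|[[sa ga] sb b2]].
  have [sa sb] := (smooth_curve_timesR I c).1 sc.
  split=> // [|t It].
    split=> // i t It ct k.
    by rewrite -(E sc i t It) //; apply: gc => //; split.
  have [i ct] := cdom_cover (c t).
  have [_ C _ _] := christoffel_product (im i t ct).
  rewrite (acceleration_snd sc It ct).
  have := gc i t It ct (rshift n 0).
  rewrite big1 ?addr0 // => a _; rewrite big1 // => b _.
  by rewrite C !mul0r.
have sc : smooth_curve I c by apply/smooth_curve_timesR.
split=> // i t It ct k; case: (split_ordP k) => k' ->.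
  by rewrite E //; apply: ga => //; case: ct.
rewrite ord1 -(acceleration_snd sc It ct) b2 // add0r.
have [_ C _ _] := christoffel_product (im i t ct).
by rewrite big1 // => a _; rewrite big1 // => b _; rewrite C !mul0r.
Qed.

End ProductGeodesics.

(** * Affine reparametrization of curves defined on the whole line *)

Section Reparametrization.
Variables (R : realType) (n : nat) (M : manifold R n) (g : metric M).
Variables (c : R -> M) (s r : R).
Hypothesis sc : smooth_curve setT c.

Let c' (t : R) : M := c (s + r * t).

Let cc' t : setT t -> {for t, continuous c'}.
Proof.
move=> _; have [_ cc _] := sc.
apply: (@continuous_comp _ _ _ (fun u : R => s + r * u) c); last exact: cc.
by apply: cvgD; [exact: cvg_cst|apply: cvgM; [exact: cvg_cst|exact: cvg_id]].
Qed.

Lemma smooth_curve_affine : smooth_curve setT c'.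
Proof.
have [oi cc sm] := sc; split=> // i k.
apply: (Ck_affine (f := cmap i \o c)
  (chart_preimage_open (i := i) openT cc') _ (sm i k)).
by move=> t [].
Qed.

Lemma velocity_affine i t : cdom i (c' t) ->
  velocity i c' t = r *: velocity i c (s + r * t).
Proof.
move=> ct; have [_ _ sm] := sc.
exact: (derive1_affine (smooth_derive1 (sm i) (conj I ct)).1).
Qed.

Lemma acceleration_affine i t : cdom i (c' t) ->
  acceleration i c' t = r ^+ 2 *: acceleration i c (s + r * t).
Proof.
move=> ct; have [_ cc sm] := sc.
exact: (derive1n2_affine (chart_preimage_open openT cc) (conj I ct) (sm i)).
Qed.

Lemma velocity_sq_affine i t : cdom i (c' t) ->
  velocity_sq g i c' t = r ^+ 2 * velocity_sq g i c (s + r * t).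
Proof.
move=> ct; rewrite /velocity_sq velocity_affine // /qform /bform.
by rewrite linearZ /= -!scalemxAl -scalemxAr !mxE mulrA -expr2.
Qed.

(** Acceleration and the term quadratic in the velocity both scale by [r ^+ 2], so the equation is
    preserved. Maximality is automatic for a curve whose domain is already all of R. *)
Lemma geodesic_affine : geodesic_on g setT c -> geodesic g setT c'.
Proof.
move=> [_ gc]; split=> [|J d _ TJ _]; last by apply/seteqP; split.
split=> [|i t _ ct k]; first exact: smooth_curve_affine.
have := gc i (s + r * t) Logic.I ct k.
move=> /(congr1 (fun z => r ^+ 2 * z)); rewrite mulr0 mulrDr => E; rewrite -[RHS]E.
rewrite acceleration_affine // velocity_affine // !mxE; congr (_ + _).
rewrite mulr_sumr; apply: eq_bigr => a _.
rewrite mulr_sumr; apply: eq_bigr => b _.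
by rewrite !mxE /c'; ring.
Qed.

End Reparametrization.

(** * Affine functions, the vertical observer, and the components of null geodesics *)

Lemma smooth_affine (R : realType) (U : set R) (p r : R) :
  smooth U (fun t : R => p + r * t).
Proof.
move=> k; apply: (@Ck_sub _ _ _ _ _ setT) => //.
apply: (@Ck_affine _ _ _ _ setT id) => //; first exact: openT.
apply: (@Ck_linear R R R k setT (idfun : {linear R -> R})).
by move=> x; exact: cvg_id.
Qed.

Lemma derive1_line (R : realType) (p r t : R) :
  derive1 (fun u : R => p + r * u) t = r.
Proof.
have did : differentiable (id : R -> R) (p + r * t) by [].
by rewrite (derive1_affine did) derive1_id /GRing.scale /= mulr1.
Qed.

Lemma derive1n2_line (R : realType) (p r t : R) :
  derive1n 2 (fun u : R => p + r * u) t = 0.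
Proof.
have E : derive1 (fun u : R => p + r * u) = cst r.
  by apply/funext => u; exact: derive1_line.
by rewrite /derive1n /= E derive1_cst.
Qed.

Lemma smooth_curve_cst (R : realType) n (M : manifold R n) (y : M) :
  smooth_curve [set: R] (cst y).
Proof.
split=> [|t _|i k]; last exact: (@Ck_cst R R _ k _ (cmap i y)).
  by split; [exact: openT|by []|exists 0].
exact: cst_continuous.
Qed.

Lemma velocity_sq_cst (R : realType) n (M : manifold R n) (g : metric M)
    (i : cindex M) (y : M) (t : R) : velocity_sq g i (cst y) t = 0.
Proof.
rewrite /velocity_sq /velocity (_ : cmap i \o cst y = cst (cmap i y)) //.
by rewrite derive1_cst /qform /bform !mul0mx mxE.
Qed.

(** The M-component is constant and the R-component is the identity, so the squared speed is 0 -
    1. *)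
Lemma timelike_vertical_line (R : realType) n (M : manifold R n)
    (h : riemannian M) (y : M) :
  timelike_curve (product_metric h) setT (fun t : R => (y, t) : timesR M).
Proof.
have sc : smooth_curve setT (fun t : R => (y, t) : timesR M).
  apply/smooth_curve_timesR; split; first exact: smooth_curve_cst.
  have := @smooth_affine R setT 0 1; rewrite (_ : (fun t => _) = id) //.
  by apply/funext => t; rewrite mul1r add0r.
split=> // t _ i ct.
rewrite (velocity_sq_product h sc (Logic.I : setT t) ct).
rewrite (_ : fst \o _ = cst y) // velocity_sq_cst (_ : snd \o _ = id) //.
by rewrite derive1_id expr1n sub0r ltrN10.
Qed.

(* Extending the M-component of a null geodesic and extending its affine
   R-component extends the null geodesic itself, so the maximality of the latter
   makes its M-component maximal. *)
Lemma null_geodesic_product (R : realType) n (M : manifold R n)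
    (h : riemannian M) (I : set R) (c : R -> timesR M) :
  geodesically_complete h -> null_geodesic (product_metric h) I c ->
  [/\ I = setT, geodesic h setT (fst \o c : R -> M) &
      exists r, [/\ r != 0, forall s t, (c t).2 = (c s).2 + r * (t - s),
        forall t, derive1 (snd \o c : R -> R) t = r &
        forall (i : cindex M) t, cdom i (c t).1 ->
          velocity_sq h i (fst \o c) t = r ^+ 2]].
Proof.
move=> hc [[gc maxc] nc].
have [ga sb b2] := (geodesic_on_product h I c).1 gc.
have sc := gc.1; have [[oI iI [t0 It0]] _ _] := sc.
set r := derive1 (snd \o c : R -> R) t0.
have aff t (It : I t) := affine_on_interval oI iI It0 sb b2 It.
have gm : geodesic h I (fst \o c : R -> M).
  split=> // J d gd IJ dc.
  (* The intercept makes the second component equal [(c t0).2] at [t0], so that [c'] agrees with [c]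
     on [I]. *)
  pose c' t : timesR M := (d t, ((c t0).2 - r * t0) + r * t).
  apply: (maxc J c') => // [|t It].
    apply/geodesic_on_product; split=> //; first exact: smooth_affine.
    by move=> t _; exact: derive1n2_line.
  rewrite /c' dc // [RHS]surjective_pairing; congr (_, _).
  by have [/= -> _] := aff t It; rewrite -/r; ring.
have IT : I = setT := hc _ _ gm.
move: It0 aff gm sc nc; rewrite IT => _ aff gm sc nc.
have vr t : derive1 (snd \o c : R -> R) t = r by exact: (aff t Logic.I).2.
have vsq (i : cindex M) t : cdom i (c t).1 ->
    velocity_sq h i (fst \o c) t = r ^+ 2.
  move=> ct.
  have ct' : cdom (i : cindex (timesR M)) (c t) by [].
  (* Nullness equates the squared speed of the M-component with the square of the slope. *)
  have [_] := nc t Logic.I i ct'.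
  by rewrite (velocity_sq_product h sc (Logic.I : setT t) ct') vr => /subr0_eq.
split=> //; exists r; split=> // [|s t].
  (* If the slope were 0, the M-component would have squared speed 0, hence velocity 0 by positive
     definiteness; the whole velocity at [t0] would vanish, which a null geodesic excludes. *)
  apply/eqP => r0; have [i ct] := cdom_cover (c t0).
  have [v0 _] := nc t0 Logic.I i ct.
  have im : cimg (i : cindex M) (cmap (i : cindex M) (c t0).1).
    by exists (c t0).1 => //; case: ct.
  have lv0 : lsubmx (velocity i c t0) = 0.
    apply/eqP; apply: contraT => lv; have := rmetric_posdef h im lv.
    rewrite -(velocity_fst sc (Logic.I : setT t0) ct) -/(velocity_sq _ _ _ _).
    by rewrite vsq ?r0 ?expr0n ?ltxx //; case: ct.
  have rv0 : rsubmx (velocity i c t0) = 0.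
    apply/rowP => j; rewrite ord1 !mxE -(velocity_snd sc (Logic.I : setT t0) ct).
    by rewrite vr r0.
  by move: v0; rewrite -(hsubmxK (velocity i c t0)) lv0 rv0 row_mx0 eqxx.
have [/= -> _] := aff s Logic.I; have [/= -> _] := aff t Logic.I.
by rewrite -/r; ring.
Qed.

(** * Refocusing of the associated spacetime *)

Theorem proposition1p11 (R : realType) (n : nat) (M : manifold R n)
    (h : riemannian M) (h_complete : geodesically_complete h) (x y : M) :
  (forall l : R, 0 < l -> Y_manifold h l x y ->
     strongly_refocusing (X := associated_spacetime h) (x, 0 : R) (y, l)) /\
  (Z_manifold h x y ->
     observer_refocusing (X := associated_spacetime h) (x, 0 : R)
       setT (fun t : R => (y, t))).
Proof.
split=> [l l0 [_ _ hY]|[_ hZ]].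
  split=> [[_ /esym/eqP]|I c gc [s _ cs]]; first by rewrite (gt_eqF l0).
  have [IT [ga _] [r [r0 cE _ vsq]]] := null_geodesic_product h_complete gc.
  have s0 : s + r^-1 * 0 = s by rewrite mulr0 addr0.
  (* The R-component is 0 at [s] and has slope [r], so it takes the value [l] at this parameter. For
     negative [r] the parameter lies before [s]. *)
  exists (s + r^-1 * l); first by rewrite IT.
  rewrite [LHS]surjective_pairing; congr (_, _).
    (* Sending [t] to [s + r^-1 * t] makes the M-component start at [x] with squared speed
       [r^-1 ^+ 2 * r ^+ 2 = 1], as the Y-property demands; its value at [l] is the one wanted. *)
    have [||_ //] := hY _ _ (geodesic_affine s r^-1 ga.1 ga) Logic.I.
      by rewrite /= s0 cs.
    move=> i ci; rewrite (velocity_sq_affine h ga.1) // s0 vsq.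
      by rewrite exprVn mulVf // expf_neq0.
    by move: ci; rewrite /= s0.
  by rewrite (cE s) cs /=; field.
split=> [|I c [gc _] _ c0]; first exact: timelike_vertical_line.
have [IT ga [r [r0 cE _ vsq]]] := null_geodesic_product h_complete gc.
(* A constant M-component would have squared speed 0, whereas it is [r ^+ 2] with [r] nonzero. *)
have nonc : nonconstant setT (fst \o c : R -> M).
  apply: contrapT => nonc.
  have cst_a : (fst \o c : R -> M) = cst x.
    apply/funext => t; apply: contrapT => ctx; apply: nonc; exists t, 0.
    by split=> //; rewrite /= c0.
  have [i xi] := cdom_cover x.
  have := vsq i 0; rewrite cst_a velocity_sq_cst c0 => /(_ xi)/esym/eqP.
  by rewrite expf_eq0 (negbTE r0).
have [|t [t0 _ ct]] := hZ _ _ ga nonc Logic.I; first by rewrite /= c0.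
exists t; split; [by []|by rewrite IT|].
(* The observer is met at its own time [(c t).2], since its parameter is the R-coordinate. *)
by exists (c t).2 => //; rewrite -ct [RHS]surjective_pairing.
Qed.
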